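(* Fix $\alpha\in[1,\tfrac32]$ and a constant $c>0$. For $N\ge1$ let $\delta=N^{-\alpha}$, let $A=\{1+iN^{-1}:1\le i\le N\}$, and let $G=\{q^i:1\le i\le N\}$ where $q>0$ satisfies $q^N-1\ge c$. Then for every $\epsilon>0$, $$|G\cap\mathcal{E}_\delta(A)|\lesssim_{\epsilon}N^{\max\{\alpha-1/2,\,(3-\alpha)/2\}+\epsilon},$$ with implicit constant independent of $N$ and $q$.
   Context: $\mathcal{E}_\delta(A)$ denotes the $\delta$-neighborhood of the set $A$ in $\mathbb{R}$. *)

(* Defs.v *)
From HB Require Import structures.
From mathcomp Require Import all_boot all_order all_algebra finmap.
From mathcomp Require Import all_classical all_reals all_analysis.
Import Order.TTheory GRing.Theory Num.Theory.
Import numFieldNormedType.Exports.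

Set Implicit Arguments.
Unset Strict Implicit.
Unset Printing Implicit Defensive.

Local Open Scope classical_set_scope.
Local Open Scope ring_scope.

(* The delta-neighborhood is taken to be open. *)
Definition neighborhood (R : realType) (delta : R) (A : set R) : set R :=
  \bigcup_(a in A) ball a delta.

Definition arith_prog (R : realType) (N : nat) : set R :=
  [set 1 + i%:R * N%:R^-1 | i in [set i : nat | (1 <= i <= N)%N]].

Arguments arith_prog R N : clear implicits.

Definition geom_prog (R : realType) (q : R) (N : nat) : set R :=
  [set q ^+ i | i in [set i : nat | (1 <= i <= N)%N]].

(* [fset_set] is [fset0] on an infinite set; this lemma shows that cardinals of
   subsets of [geom_prog q N] taken through [fset_set] are the actual ones. *)
Lemma finite_geom_prog (R : realType) (q : R) (N : nat) :
  finite_set (geom_prog q N).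
Proof.
apply: finite_image; apply: (@sub_finite_set _ _ `I_N.+1) => [i|]; last exact: finite_II.
by rewrite /= ltnS => /andP[].
Qed.

(* Main.v *)
(* Put t = q - 1, which is at least ln (1 + c) / N, and B = N^((alpha - 1)/2), so
   that N delta = B^-2 and B^4 <= N. The relevant exponents i are those for which
   q^i <= 3 and N q^i is within B^-2 of an integer; there are O(N / B) of them,
   and N / B = N^((3 - alpha)/2). Indeed, i t <= q^i - 1 <= 2 settles the case
   t >= B / (2N). Otherwise, O(N / B) of the exponents have no other one among
   their B successors. For each of the remaining ones there is 1 <= a <= B such
   that i + a also qualifies; then, with u = q^a - 1, the number
   N u q^i = N q^(i+a) - N q^i is within 2 B^-2 of an integer. It lies in
   [N u, 3 N u] and grows by at least N u t with i, so that at most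
   (2 N u + O(1)) (1 + O(1 / (B^2 N u t))) exponents i share a given a. Since
   t <= u, N t >= ln (1 + c) and N u <= B^2 <= N / B^2, this is O(N / B^2), and
   summing over a <= B gives O(N / B). *)

Require Import Defs.
From HB Require Import structures.
From mathcomp Require Import all_boot all_order all_algebra finmap.
From mathcomp Require Import all_classical all_reals all_analysis.
From mathcomp Require Import ring lra.
Import Order.TTheory GRing.Theory Num.Theory.
Import numFieldNormedType.Exports.

Set Implicit Arguments.
Unset Strict Implicit.
Unset Printing Implicit Defensive.

Local Open Scope classical_set_scope.
Local Open Scope ring_scope.

(** * Counting by cells of a grid *)

Lemma dist_lt_of_truncn_eq (R : realType) (X s u v : R) :
  0 < s -> X <= u -> X <= v ->
  Num.truncn ((u - X) / s) = Num.truncn ((v - X) / s) -> `|u - v| < s.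
Proof.
move=> s0 Xu Xv e.
have pos w : X <= w -> 0 <= (w - X) / s by move=> Xw; rewrite divr_ge0 ?subr_ge0 // ltW.
have /andP[lu uu] := truncn_itv (pos _ Xu).
have /andP[lv uv] := truncn_itv (pos _ Xv).
move: lu uu; rewrite e.
move: lv uv; rewrite -natr1 !ler_pdivlMr // !ltr_pdivrMr // => *.
by rewrite ltr_norml; apply/andP; split; lra.
Qed.

(** Pigeonhole: the rectangle is cut into cells of size [s] by [r], and the last hypothesis allows
    one point per cell. With [y] constant and [M = 0] this counts separated points on a line. *)
Lemma card_le_grid (R : realType) (T : finType) (P : {set T}) (x y : T -> R)
    (X Y L M s r : R) :
  0 < s -> 0 < r -> 0 <= L -> 0 <= M ->
  {in P, forall i, X <= x i <= X + L} -> {in P, forall i, Y <= y i <= Y + M} ->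
  {in P &, forall i j, `|x i - x j| < s -> `|y i - y j| < r -> i = j} ->
  #|P|%:R <= (L / s + 1) * (M / r + 1).
Proof.
move=> s0 r0 L0 M0 hx hy inj.
have cell (Z K w d : R) : 0 < d -> Z <= w <= Z + K ->
    (Num.truncn ((w - Z) / d) < (Num.truncn (K / d)).+1)%N.
  move=> d0 /andP[_ h]; rewrite ltnS; apply: le_truncn.
  by rewrite ler_pM2r ?invr_gt0 //; lra.
pose f i : 'I_(Num.truncn (L / s)).+1 * 'I_(Num.truncn (M / r)).+1 :=
  (inord (Num.truncn ((x i - X) / s)), inord (Num.truncn ((y i - Y) / r))).
have /leq_card_in : {in P &, injective f}.
  move=> i j Pi Pj [/(congr1 val) /= e1 /(congr1 val) /= e2].
  move: e1 e2; rewrite !inordK ?cell ?hx ?hy // => e1 e2.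
  have [/andP[? _] /andP[? _]] := (hx i Pi, hx j Pj).
  have [/andP[? _] /andP[? _]] := (hy i Pi, hy j Pj).
  by apply: inj => //; apply: dist_lt_of_truncn_eq; eassumption.
rewrite card_prod !card_ord => h.
have {h} : (#|P|%:R : R) <= ((Num.truncn (L / s)).+1 * (Num.truncn (M / r)).+1)%:R.
  by rewrite ler_nat.
move=> /le_trans; apply; rewrite natrM -!natr1.
by apply: ler_pM; rewrite ?addr_ge0 // lerD2r truncn_le divr_ge0 // ltW.
Qed.

(** * Union bound and elementary estimates on powers *)

Lemma leq_card_bigcup (I T : finType) (F : I -> {set T}) :
  (#|(\bigcup_i F i)%SET| <= \sum_i #|F i|)%N.
Proof.
elim/big_ind2: _ => [|A m B n hA hB|//]; first by rewrite cards0.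
by apply: leq_trans (leq_card_setU _ _) _; rewrite leq_add.
Qed.

(** Induction gives [(1 + t) ^+ a * (1 - a t) <= 1], and [1 / (1 - z) <= 1 + 2 z] for
    [0 <= z <= 1 / 2]. *)
Lemma expr1Dx_le (R : realFieldType) (t : R) (a : nat) :
  0 <= t -> a%:R * t <= 1 / 2 -> (1 + t) ^+ a <= 1 + 2 * a%:R * t.
Proof.
move=> t0 at2.
have bd : (1 + t) ^+ a * (1 - a%:R * t) <= 1.
  elim: a at2 => [|a IH] at2; first by rewrite expr0 mul0r; lra.
  rewrite -natr1 in at2 *.
  apply: le_trans (IH _); last by lra.
  rewrite exprSr -mulrA ler_wpM2l ?exprn_ge0 //; first by lra.
  have a0 : 0 <= (a%:R : R) by [].
  by nra.
have e1 : 1 <= (1 + 2 * a%:R * t) * (1 - a%:R * t).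
  have : 0 <= a%:R * t by rewrite mulr_ge0.
  set z := a%:R * t in at2 bd *; rewrite -mulrA -/z => z0; nra.
rewrite -(ler_pM2r (_ : 0 < 1 - a%:R * t)); last by lra.
exact: le_trans e1.
Qed.

Lemma expr_gap (R : realFieldType) (q : R) (i j : nat) :
  1 <= q -> (i < j)%N -> q - 1 <= q ^+ j - q ^+ i.
Proof.
move=> q1 ij; rewrite -(subnK ij) exprD exprS.
have h1 : 1 <= q ^+ (j - i.+1) by rewrite exprn_ege1.
have h2 : 1 <= q ^+ i by rewrite exprn_ege1.
set u := q ^+ _ in h1 *; set v := q ^+ i in h2 *.
have : 0 <= (u - 1) * (q * v) by rewrite mulr_ge0 ?mulr_ge0; lra.
have : 0 <= (v - 1) * (q - 1) by rewrite mulr_ge0; lra.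
lra.
Qed.

(** * Pairs of exponents at a fixed gap *)

(** Subtracting the approximations at [i] and [i + a] puts [D * u * q ^+ i] within [2 * b] of an
    integer, where [u = q ^+ a - 1]. Exponents sharing that integer have offsets at least
    [D * u * (q - 1)] apart in an interval of length [4 * b]. *)
Lemma card_shift_le (R : realType) (n a : nat) (D q b : R) (S : {set 'I_n})
    (m : nat -> int) :
  0 < D -> 1 < q -> 0 < b -> (0 < a)%N ->
  {in S, forall i : 'I_n, q ^+ i <= 3} ->
  {in S, forall i : 'I_n, `|D * q ^+ i - (m i)%:~R| <= b} ->
  #|[set i in S | [exists j in S, j == (i + a)%N :> nat]]%SET|%:R
    <= (4 * b / (D * (q ^+ a - 1) * (q - 1)) + 1)
       * (2 * D * (q ^+ a - 1) + 4 * b + 1).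
Proof.
move=> D0 q1 b0 a0 S3 Sm; set u := q ^+ a - 1.
rewrite -[2 * D * u + 4 * b]divr1.
have u0 : 0 < u by rewrite subr_gt0 exprn_egt1 // -lt0n.
have t0 : 0 < q - 1 by rewrite subr_gt0.
have q1' := ltW q1.
have Du0 : 0 < D * u by rewrite mulr_gt0.
have near i : i \in [set i in S | [exists j in S, j == (i + a)%N :> nat]]%SET ->
    `|D * u * q ^+ i - (m (i + a)%N - m i)%:~R| <= 2 * b /\ 1 <= q ^+ i <= 3.
  rewrite inE => /andP[Si /existsP[j /andP[Sj /eqP ji]]].
  rewrite S3 // exprn_ege1 //; split=> //.
  have := Sm j Sj; rewrite ji => hj; have hi := Sm i Si.
  have -> : D * u * q ^+ i - (m (i + a)%N - m i)%:~R
          = (D * q ^+ (i + a) - (m (i + a)%N)%:~R) - (D * q ^+ i - (m i)%:~R).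
    by rewrite intrD mulrNz exprD /u; ring.
  by apply: le_trans (ler_normB _ _) _; lra.
(* The first coordinate is the offset of D u q^i to a nearby integer, the second
   one is that integer. *)
apply: (@card_le_grid _ _ _
  (fun i : 'I_n => D * u * q ^+ i - (m (i + a)%N - m i)%:~R)
  (fun i : 'I_n => (m (i + a)%N - m i)%:~R) (- (2 * b)) (D * u - 2 * b)).
- by rewrite mulr_gt0.
- by [].
- by lra.
- by lra.
- by move=> i /near[+ _]; rewrite ler_norml => /andP[? ?]; apply/andP; split; lra.
- move=> i /near[+ /andP[h1 h2]]; rewrite ler_norml => /andP[? ?].
  have ? : D * u * 1 <= D * u * q ^+ i by rewrite ler_wpM2l // ltW.
  have ? : D * u * q ^+ i <= D * u * 3 by rewrite ler_wpM2l // ltW.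
  by apply/andP; split; lra.
- move=> i j _ _ /= + hk.
  (* Integers less than 1 apart are equal, so the offsets differ by exactly
     [D * u * (q ^+ i - q ^+ j)]. *)
  have -> : m (j + a)%N - m j = m (i + a)%N - m i.
    apply/eqP; rewrite eq_sym -subr_eq0 -normr_le0 -ltzD1 add0r.
    by rewrite -(ltr_int R) intr_norm intrD mulrNz.
  set k := _%:~R => hx; apply/val_inj/eqP.
  have gap (i' j' : 'I_n) : (i' < j')%N ->
      D * u * (q - 1) <= D * u * q ^+ j' - D * u * q ^+ i'.
    by move=> ij; rewrite -mulrBr; apply: ler_wpM2l; [exact: ltW|exact: expr_gap].
  move: hx; rewrite ltr_norml => /andP[hx1 hx2].
  by case: ltngtP => // /gap; lra.
Qed.

(** * Exponents [i] with [N q^i] near an integer *)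

Lemma card_near_int_le (R : realType) (N : nat) (q B kappa : R)
    (S : {set 'I_N.+1}) (m : nat -> int) :
  1 <= B -> B ^+ 4 <= N%:R -> 0 < kappa -> kappa <= N%:R * (q - 1) ->
  {in S, forall i : 'I_N.+1, q ^+ i <= 3} ->
  {in S, forall i : 'I_N.+1, `|N%:R * q ^+ i - (m i)%:~R| <= B ^- 2} ->
  #|S|%:R <= (9 + 8 / kappa + 20 / kappa ^+ 2) * (N%:R / B).
Proof.
set n : R := N%:R => B1 B4 k0 kt S3 Sm.
have B0 : 0 < B by lra.
have n0 : 0 < n by apply: lt_le_trans B4; rewrite exprn_gt0.
have t0 : 0 < q - 1 by rewrite -(pmulr_rgt0 _ n0); apply: lt_le_trans kt.
have q1 : 1 < q by lra.
have q1' := ltW q1.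
have Bn : B <= n by apply: le_trans B4; rewrite -[leLHS]expr1 ler_weXn2l.
set Q := n / B.
have Q1 : 1 <= Q by rewrite ler_pdivlMr // mul1r.
have kp : 0 <= 8 / kappa + 20 / kappa ^+ 2.
  by rewrite addr_ge0 // divr_ge0 // ?exprn_ge0 // ltW.
have [large|small] := leP (B / (2 * n)) (q - 1).
  have S2t i : i \in S -> i%:R * (q - 1) <= 2.
    move=> Si; have := S3 i Si.
    have : 1 + i%:R * (q - 1) <= q ^+ i.
      elim: (nat_of_ord i) => [|j IH]; first by rewrite mul0r addr0 expr0.
      have := expr_gap q1' (ltnSn j); rewrite -natr1; lra.
    lra.
  (* Here [i * (q - 1) <= 2] and [q - 1 >= B / (2 * n)] force [i <= 4 * Q]; unit cells then separate
     the exponents. *)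
  have L0 : 0 <= 4 * Q by lra.
  apply: le_trans (@card_le_grid R _ S (fun i => i%:R) (fun=> 0) 0 0 (4 * Q) 0 1 1
    ltr01 ltr01 L0 (lexx 0) _ _ _) _; last first.
  - have : 0 <= (8 / kappa + 20 / kappa ^+ 2) * Q by apply: mulr_ge0 => //; lra.
    by rewrite -/Q; lra.
  - move=> i j _ _ + _; rewrite ltr_norml => /andP[h1 h2].
    have gap (k l : nat) : (k < l)%N -> 1 <= l%:R - k%:R :> R.
      by move=> kl; rewrite lerBrDl natr1 ler_nat.
    by apply/val_inj/eqP; case: ltngtP => // /gap; lra.
  - by move=> i _; rewrite /= addr0 lexx.
  - move=> i Si; rewrite /= add0r ler0n /=.
    have h : i%:R * (B / (2 * n)) <= 2.
      by apply: le_trans (S2t i Si); rewrite ler_wpM2l.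
    rewrite /Q mulrA ler_pdivlMr //.
    by move: h; rewrite mulrA ler_pdivrMr; lra.
pose A := Num.truncn B.
have /andP[AB BA] : A%:R <= B < A.+1%:R by apply: truncn_itv; lra.
pose P (a : nat) := [set i in S | [exists j in S, j == (i + a)%N :> nat]]%SET.
(* The index [a.+1] runs over the gaps 1, ..., [A], so distinct exponents in [S1] differ by at least
   [A.+1 > B]. *)
pose S1 := (S :\: \bigcup_(a < A) P a.+1)%SET.
have cS1 : #|S1|%:R <= 2 * Q.
  apply: le_trans (@card_le_grid R _ S1 (fun i => i%:R) (fun=> 0) 0 0 n 0 B 1
    B0 ltr01 (ltW n0) (lexx 0) _ _ _) _; last first.
  - by rewrite -/Q; lra.
  - have sep (i j : 'I_N.+1) : i \in S1 -> j \in S1 -> (i < j)%N -> B <= j%:R - i%:R.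
      move=> /setDP[Si nPi] /setDP[Sj _] ij.
      rewrite -natrB 1?ltnW //; apply: le_trans (ltW BA) _.
      rewrite ler_nat ltnNge; apply: contra nPi => jiA.
      have h : ((j - i).-1 < A)%N by rewrite prednK ?subn_gt0.
      apply/bigcupP; exists (Ordinal h) => //.
      rewrite inE Si; apply/existsP; exists j; rewrite Sj /=.
      by rewrite prednK ?subn_gt0 // subnKC // ltnW.
    move=> i j Si Sj + _; rewrite ltr_norml => /andP[h1 h2].
    apply/val_inj/eqP.
    by case: ltngtP => // [/(sep _ _ Si Sj)|/(sep _ _ Sj Si)]; lra.
  - by move=> i _; rewrite /= addr0 lexx.
  - by move=> i _; rewrite /= add0r ler0n ler_nat -ltnS ltn_ord.
(* Here 7 = 2 + 4 + 1 pays for [2 * (n * u)], [4 * G] and 1 below, and 20 = 4 * 5 comes from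
   [4 * G + 1 <= 5]. The factor 2 of [cS1] raises 7 to the final 9. *)
pose K := 7 + 8 / kappa + 20 / kappa ^+ 2.
have K0 : 0 <= K by rewrite /K; lra.
have cP (a : 'I_A) : #|P a.+1|%:R <= K * (n / B ^+ 2).
  have G0 : 0 < B ^- 2 by rewrite invr_gt0 exprn_gt0.
  have := @card_shift_le R _ a.+1 n q _ S m n0 q1 G0 isT S3 Sm.
  move=> /le_trans; apply.
  set u := q ^+ a.+1 - 1; set G := B ^- 2 in G0 *; set W := n * G.
  have G1 : G <= 1 by rewrite invf_le1 ?exprn_gt0 // exprn_ege1.
  have aB : a.+1%:R <= B by apply: le_trans AB; rewrite ler_nat.
  (* This is [B ^+ 4 <= n]; it lets [W] absorb both [n * u] and the constants. *)
  have BBW : B ^+ 2 <= W.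
    by rewrite /W ler_pdivlMr ?exprn_gt0 // -exprD.
  have BB1 : 1 <= B ^+ 2 by rewrite exprn_ege1.
  (* The threshold [B / (2 * n)] makes this product at most [B ^+ 2 / (2 * n) <= 1 / 2], so that
     [expr1Dx_le] applies and yields [n * u <= B ^+ 2]. *)
  have at2 : a.+1%:R * (q - 1) <= B * (B / (2 * n)).
    by rewrite ler_pM // ltW.
  have nat2 : n * (2 * a.+1%:R * (q - 1)) <= B ^+ 2.
    have := ler_wpM2l (ltW n0) at2.
    have -> : n * (B * (B / (2 * n))) = B ^+ 2 / 2 by field; lra.
    lra.
  have Bn2 : B ^+ 2 <= n by apply: le_trans B4; rewrite ler_weXn2l.
  have nu : n * u <= B ^+ 2.
    apply: le_trans nat2; apply: ler_wpM2l; [exact: ltW|rewrite /u].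
    have := @expr1Dx_le R (q - 1) a.+1 (ltW t0).
    have -> : 1 + (q - 1) = q by ring.
    have -> : a.+1%:R * (q - 1) <= 1 / 2.
      apply: le_trans at2 _; rewrite mulrA ler_pdivrMr; last by lra.
      by rewrite -expr2; lra.
    by move=> /(_ isT); lra.
  have ut : q - 1 <= u by rewrite -{1}[q]expr1 lerD2r ler_weXn2l.
  have u0 : 0 < u by lra.
  have tk : (q - 1)^-1 <= n / kappa.
    rewrite -invf_div lef_pV2 ?posrE ?divr_gt0 // ler_pdivrMr //; lra.
  (* Both [n * (q - 1)] and [n * u] are at least [kappa], since [q - 1 <= u]. *)
  have utk : (n * u * (q - 1))^-1 <= n / kappa ^+ 2.
    rewrite -invf_div lef_pV2 ?posrE ?divr_gt0 ?exprn_gt0 ?mulr_gt0 //.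
    rewrite ler_pdivrMr //.
    have : kappa * kappa <= (n * (q - 1)) * (n * u).
      by apply: (ler_pM (ltW k0) (ltW k0) kt); apply: le_trans kt _; rewrite ler_pM2l.
    by rewrite expr2; lra.
  have -> : (4 * G / (n * u * (q - 1)) + 1) * (2 * n * u + 4 * G + 1)
     = 8 * G * (q - 1)^-1 + 4 * (4 * G + 1) * (G * (n * u * (q - 1))^-1)
       + (2 * (n * u) + 4 * G + 1).
    by field; lra.
  have h1 : G * (q - 1)^-1 <= G * (n / kappa) by rewrite ler_wpM2l // ltW.
  have h2 : G * (n * u * (q - 1))^-1 <= G * (n / kappa ^+ 2).
    by rewrite ler_wpM2l // ltW.
  have h3 : (4 * G + 1) * (G * (n * u * (q - 1))^-1) <= 5 * (G * (n / kappa ^+ 2)).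
    apply: ler_pM => //; try lra.
    by rewrite mulr_ge0 ?invr_ge0 ?mulr_ge0 // ltW.
  have -> : K * W = 7 * W + 8 * (G * (n / kappa)) + 20 * (G * (n / kappa ^+ 2)).
    by rewrite /K /W; field; lra.
  lra.
have : (#|S| <= #|S1| + \sum_(a < A) #|P a.+1|)%N.
  apply: leq_trans (leq_add (leqnn _) (leq_card_bigcup _)).
  apply: leq_trans (leq_card_setU _ _).
  by apply/subset_leq_card/fintype.subsetP => i Si; rewrite !inE Si andbT orNb.
rewrite -(ler_nat R) natrD natr_sum => /le_trans; apply.
have : \sum_(a < A) #|P a.+1|%:R <= \sum_(a < A) K * (n / B ^+ 2).
  by apply: ler_sum => a _.
rewrite sumr_const card_ord -mulr_natl => hs.
have : A%:R * (K * (n / B ^+ 2)) <= K * Q.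
  have -> : K * Q = B * (K * (n / B ^+ 2)) by rewrite /Q; field; lra.
  by rewrite ler_wpM2r // mulr_ge0 // divr_ge0 ?exprn_ge0 // ltW.
have -> : 9 + 8 / kappa + 20 / kappa ^+ 2 = 2 + K by rewrite /K; ring.
lra.
Qed.

(** * Reduction of the intersection to near-integers *)

Theorem theorem5 (R : realType) (alpha c : R)
    (halpha : 1 <= alpha <= 3 / 2) (hc : 0 < c)
    (eps : R) (heps : 0 < eps) :
  exists2 C : R, 0 < C &
    forall (N : nat) (q : R), (1 <= N)%N -> 0 < q -> c <= q ^+ N - 1 ->
      let delta := N%:R `^ (- alpha) in
      (#|` fset_set (geom_prog q N `&` neighborhood delta (arith_prog R N)) |)%fset%:R
        <= C * N%:R `^ (Num.max (alpha - 1 / 2) ((3 - alpha) / 2) + eps).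
Proof.
have [a1 a2] := andP halpha.
pose kappa := ln (1 + c).
have k0 : 0 < kappa by rewrite ln_gt0 // ltrDl.
exists (9 + 8 / kappa + 20 / kappa ^+ 2).
  by rewrite addr_gt0 ?addr_gt0 ?divr_gt0 ?exprn_gt0.
move=> N q N1 q0 hq; cbv zeta; set delta := _ `^ (- alpha).
set n : R := N%:R.
have n1 : 1 <= n by rewrite ler1n.
have n0 : 0 < n by lra.
have q1 : 1 < q.
  rewrite ltNge; apply/negP => qle.
  have : q ^+ N <= 1 by rewrite exprn_ile1 // ltW.
  lra.
(* This exponent gives [n * delta = B ^- 2]; [1 <= alpha] gives [1 <= B], and [alpha <= 3 / 2] gives
   [B ^+ 4 <= n]. *)
pose B := n `^ ((alpha - 1) / 2).
have B1 : 1 <= B by rewrite -[leLHS](powRr0 n); apply: ler_powR => //; lra.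
have powB k : B ^+ k = n `^ ((alpha - 1) / 2 * k%:R).
  by rewrite -powR_mulrn ?powR_ge0 // -powRrM.
have B4 : B ^+ 4 <= n.
  by rewrite powB; apply: ler1_powR => //; lra.
(* [ln (1 + c) <= ln (q ^+ N) = N ln q <= N (q - 1)]. *)
have kt : kappa <= n * (q - 1).
  have : kappa <= ln (q ^+ N) by rewrite ler_ln ?posrE ?exprn_gt0; lra.
  rewrite lnXn // -mulr_natl => /le_trans; apply.
  apply: ler_wpM2l => //.
  have := @le_ln1Dx R (q - 1); rewrite subrKC; apply; lra.
have dB : n * delta = B ^- 2.
  rewrite powB -powRN /delta -{1}[n]powRr1 1?ltW // -powRD; last first.
    by apply/implyP => _; rewrite gt_eqF.
  by congr (_ `^ _); field.
have d1 : delta <= 1.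
  by rewrite -[leRHS](powRr0 n); apply: ler_powR => //; lra.
pose near (i : nat) (k : int) :=
  q ^+ i <= 3 /\ `|n * q ^+ i - k%:~R| <= B ^- 2.
(* The default 0 is harmless: [S] contains only exponents that have a near integer. *)
have /choice[m hm] : forall i, exists k : int, (exists k', near i k') -> near i k.
  move=> i; have [[k hk]|h] := pselect (exists k', near i k').
    by exists k.
  by exists 0.
pose S := [set i : 'I_N.+1 | `[< exists k, near i k >]]%SET.
have Snear : {in S, forall i : 'I_N.+1, near i (m i)}.
  by move=> i; rewrite inE => /asboolP; exact: hm.
have cS : #|S|%:R <= (9 + 8 / kappa + 20 / kappa ^+ 2) * (n / B).
  by apply: (@card_near_int_le _ N q B kappa S m) => // i /Snear[].
apply: (@le_trans _ _ #|S|%:R).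
  rewrite ler_nat.
  apply: (@leq_trans #|` [fset q ^+ (i : 'I_N.+1) | i in S]%fset|); last first.
    by rewrite cardE; apply: leq_imfset_card.
  apply: fsubset_leq_card; apply/fsubsetP => x.
  rewrite in_fset_set; last first.
    by apply: finite_setIl; exact: finite_geom_prog.
  rewrite inE => -[[i /= /andP[i1 iN] <-] [y [j /= /andP[j1 jN] <-]]].
  rewrite /ball /= => hb.
  have iN' : (i < N.+1)%N by [].
  apply/imfsetP; exists (Ordinal iN') => //=.
  (* Multiplying [1 + j / N] by [N] gives the integer [N + j] and turns the radius [delta] into
     [B ^- 2]; moreover [q ^+ i <= 2 + delta <= 3]. *)
  rewrite inE; apply/asboolP; exists (N + j)%N%:Z; split=> /=.
    have jn : j%:R * n^-1 <= 1 by rewrite ler_pdivrMr // mul1r ler_nat.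
    by move: hb; rewrite ltr_norml => /andP[? ?]; lra.
  have -> : n * q ^+ i - (N + j)%N%:Z%:~R = - (n * (1 + j%:R * n^-1 - q ^+ i)).
    by rewrite -pmulrn natrD -/n; field; lra.
  by rewrite normrN normrM gtr0_norm // -dB ler_wpM2l // ltW.
apply: le_trans cS _.
apply: ler_wpM2l.
  by rewrite ltW // addr_gt0 ?addr_gt0 ?divr_gt0 ?exprn_gt0.
(* The exponent of [n / B] is [1 - (alpha - 1) / 2 = (3 - alpha) / 2]. *)
rewrite -{1}[n]powRr1 ?(ltW n0) // /B -powRN -powRD; last first.
  by apply/implyP => _; rewrite gt_eqF.
apply: ler_powR => //.
have : (3 - alpha) / 2 <= Num.max (alpha - 1 / 2) ((3 - alpha) / 2).
  by rewrite le_max lexx orbT.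
lra.
Qed.
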